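(* Let $(E;\oplus,0,1)$ be an atomic lattice effect algebra. The following conditions are equivalent: (i) $E$ is Archimedean and sharply dominating. (ii) For every $x\in E$, $x\neq 0$, there exist a unique $v_x\in S(E)$, a unique (possibly empty) set of atoms $\{a_\alpha\mid\alpha\in\Lambda\}$ of $E$ and unique positive integers $k_\alpha\neq\mathrm{ord}(a_\alpha)$ ($\alpha\in\Lambda$) such that $$x=v_x\oplus\Big(\bigoplus\{k_\alpha a_\alpha\mid\alpha\in\Lambda\}\Big).$$
   Context: An effect algebra $(E;\oplus,0,1)$ is a set $E$ with two distinguished elements $0,1$ and a partially defined binary operation $\oplus$ such that for all $a,b,c\in E$: (Ei) $a\oplus b=b\oplus a$ if $a\oplus b$ is defined; (Eii) $(a\oplus b)\oplus c=a\oplus(b\oplus c)$ if one side is defined; (Eiii) for each $a$ there is a unique $b$, denoted $a'$, with $a\oplus b=1$; (Eiv) if $1\oplus a$ is defined then $a=0$. The partial order is given by: $a\leq b$ iff there is $c$ with $a\oplus c$ defined and equal to $b$. $E$ is a lattice effect algebra if $(E,\leq)$ is a lattice. A nonzero element $a$ is an atom if $0\leq b<a$ implies $b=0$; $E$ is atomic if for every nonzero $x\in E$ there is an atom $a\leq x$. For a positive integer $n$, $nx=x\oplus\dots\oplus x$ ($n$ times), when defined. $E$ is Archimedean if for no nonzero $e\in E$ do the elements $ne$ exist for all positive integers $n$. $\mathrm{ord}(x)=\infty$ if $nx$ exists for every positive integer $n$; otherwise $\mathrm{ord}(x)=n_x$ is the greatest integer such that $n_xx$ exists. $S(E)=\{x\in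 E\mid x\wedge x'=0\}$ is the set of sharp elements. $E$ is sharply dominating if for every $a\in E$ there exists a smallest sharp element $\hat a$ with $a\leq\hat a$ (i.e. $\hat a\in S(E)$, $a\leq \hat a$, and $b\in S(E)$, $a\leq b$ imply $\hat a\leq b$). A finite system $(x_k)_{k=1}^n$ of elements is $\oplus$-orthogonal if $x_1\oplus\dots\oplus x_n$ exists in $E$. An arbitrary system $G=(x_\kappa)_{\kappa\in H}$ is $\oplus$-orthogonal if $\bigoplus K$ exists for every finite $K\subseteq G$; for such $G$, $\bigoplus G$ exists iff $\bigvee\{\bigoplus K\mid K\subseteq G\text{ finite}\}$ exists in $E$, and then $\bigoplus G$ is this supremum; the empty sum is $0$. In (ii), the atoms $a_\alpha$ are pairwise distinct (they form a set), the equality includes the assertion that all multiples and sums in it exist, and uniqueness means that the whole data ($v_x$, the set of atoms, and the multiplicity attached to each atom) is uniquely determined by $x$. *)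

(* Defs.v *)
From Stdlib Require List.
From mathcomp Require Import all_boot.
From mathcomp Require Import boolp classical_sets.

Set Implicit Arguments.
Unset Strict Implicit.
Unset Printing Implicit Defensive.

Local Open Scope classical_set_scope.

(* The partial sum is option-valued, [None] meaning "undefined"; an equality of
   options thus says that if one side is defined, then so is the other, with
   the same value. *)
Record effectAlgebra := EffectAlgebra {
  carrier :> Type;
  ezero : carrier;
  eone : carrier;
  oplus : carrier -> carrier -> option carrier;
  ecompl : carrier -> carrier;
  oplusC : forall a b, oplus a b = oplus b a;
  oplusA : forall a b c,
    obind (fun ab => oplus ab c) (oplus a b) =
    obind (fun bc => oplus a bc) (oplus b c);
  oplus_compl : forall a, oplus a (ecompl a) = Some eone;
  ecompl_uniq : forall a b, oplus a b = Some eone -> b = ecompl a;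
  oplus1_def : forall a, oplus eone a <> None -> a = ezero
}.

Arguments ezero {e}.
Arguments eone {e}.

Section EffectAlgebraTheory.
Variable E : effectAlgebra.
Implicit Types (a b c x y v w : E) (A : set E) (k : E -> nat).

Definition ele a b : Prop := exists c, oplus a c = Some b.

Definition elt a b : Prop := ele a b /\ a <> b.

Definition is_lub A y : Prop :=
  (forall a, A a -> ele a y) /\
  (forall z, (forall a, A a -> ele a z) -> ele y z).

Definition is_glb A y : Prop :=
  (forall a, A a -> ele y a) /\
  (forall z, (forall a, A a -> ele z a) -> ele z y).

Definition is_lattice : Prop :=
  forall a b, (exists y, is_lub [set a; b] y) /\ (exists y, is_glb [set a; b] y).

Definition atom a : Prop :=
  a <> ezero /\ forall b, ele ezero b -> elt b a -> b = ezero.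

Definition atomic : Prop :=
  forall x, x <> ezero -> exists2 a, atom a & ele a x.

Definition osum (s : seq E) : option E :=
  foldr (fun a acc => obind (oplus a) acc) (Some ezero) s.

Definition nmul (n : nat) x : option E := osum (nseq n x).

Definition archimedean : Prop :=
  ~ exists2 e, e <> ezero & forall n, 0 < n -> nmul n e <> None.

(* [None] stands for infinity. *)
Definition ord x : option nat :=
  if `[< forall n, 0 < n -> nmul n x <> None >] then None
  else Some (get [set n | nmul n x <> None /\
                          forall m, nmul m x <> None -> m <= n]).

Definition sharp : set E := [set x | is_glb [set x; ecompl x] ezero].

Definition sharply_dominating : Prop :=
  forall a, exists w,
    [/\ sharp w, ele a w & forall b, sharp b -> ele a b -> ele w b].

(* Systems are indexed by a set [D] of indices, so that repeated values are
   counted with their multiplicity; a finite subsystem is given by a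
   duplicate-free list of indices taken in [D]. *)
Definition finite_subsystem (I : Type) (D : set I) (s : seq I) : Prop :=
  List.NoDup s /\ forall i, List.In i s -> D i.

Definition orthogonal (I : Type) (D : set I) (g : I -> E) : Prop :=
  forall s, finite_subsystem D s -> osum (map g s) <> None.

Definition is_bigoplus (I : Type) (D : set I) (g : I -> E) y : Prop :=
  orthogonal D g /\
  is_lub [set z | exists2 s, finite_subsystem D s & osum (map g s) = Some z] y.

(* Only the values of [k] on [A] matter; [g a] is the element [k a] times [a],
   which is required to exist. *)
Definition decomposition x v A k : Prop :=
  [/\ sharp v,
      forall a, A a -> atom a,
      forall a, A a -> 0 < k a /\ Some (k a) <> ord a
    & exists g : E -> E, exists y : E,
        [/\ forall a, A a -> nmul (k a) a = Some (g a),
            is_bigoplus A g y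
          & oplus v y = Some x]].

Definition unique_decomposition x : Prop :=
  (exists v A k, decomposition x v A k) /\
  (forall v1 v2 A1 A2 k1 k2,
     decomposition x v1 A1 k1 -> decomposition x v2 A2 k2 ->
     [/\ v1 = v2, A1 = A2 & forall a, A1 a -> k1 a = k2 a]).

End EffectAlgebraTheory.

Arguments is_lattice E : clear implicits.
Arguments atomic E : clear implicits.
Arguments archimedean E : clear implicits.
Arguments sharply_dominating E : clear implicits.

(* Main.v *)
From Stdlib Require List.
Require Import Defs.
From mathcomp Require Import all_boot.
From mathcomp Require Import boolp classical_sets.

(** Everything rests on one property of lattice effect algebras: if [a] and [b]
    are disjoint (their meet is zero) and [a ⊕ b] exists, then [a ⊕ b] is their
    join ([disj_sum_lub]).  Two consequences are used throughout.

    Orthogonality together with disjointness ([perp]) passes from the summands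
    to a sum ([perp_sum], [perp_osum]), and disjointness even passes to an
    infinite sum ([perp_bigoplus]).  Moreover, a join [u] of two elements that
    are both disjoint from the complement of [u] is sharp
    ([sharp_join_disj]).  So joins and orthogonal sums of sharp elements are
    sharp, and, decisively, so is the join of two non-orthogonal atoms.

    Call [y] meager if zero is the only sharp element below it.  Writing
    [x = v ⊕ y], the element [v] is the greatest sharp element below [x] iff
    [v] is sharp and [y] is meager, and [E] is sharply dominating iff every
    element has a greatest sharp element below it (pass to complements).  The
    theorem thus becomes a statement about meager elements.

    - Existence.  Distinct atoms below a meager [y] are orthogonal, since their
      join would otherwise be a nonzero sharp element below [y].  Hence the
      largest multiples [k a] that lie below [y], over all atoms [a] below [y],
      form an orthogonal system, whose sum is [y] by maximality of the [k a].
      None of these is the full multiple [ord(a) a], because the latter is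
      sharp ([nmul_exact_sharp], [meager_bigoplus]).

    - Uniqueness.  Conversely let [y] be a sum of multiples [k a], with [k a]
      different from [ord a], over a set [A] of atoms.  Splitting off the
      summand of [a] leaves a sum of multiples of other atoms, from which [a] is
      disjoint, so the multiple [k a + 1] of [a] is not below [y].  A sharp
      element above [a] contains every multiple of [a], so no sharp element
      below [y] contains an atom of [A].  An atom [b] below [y] and outside [A]
      would be disjoint from [y] if it were orthogonal to all of [A]; otherwise
      the join of [b] with some [a] in [A] would be such a sharp element.
      Therefore [A] is the set of atoms below [y], [k] gives the largest
      multiples below [y], and [y] is meager, so that [v] is the greatest sharp
      element below [x].

    - From decompositions back to the Archimedean property.  If an element had
      all multiples, so would an atom [a] below it, that is, [ord a] would be
      infinite.  Adding one more copy of [a] to a decomposition of the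
      complement of [a] gives a decomposition of one with a nonempty set of
      atoms, next to the trivial one [1 = 1 ⊕ 0].  Once the Archimedean property
      is known, the uniqueness argument shows that decompositions produce
      greatest sharp elements. *)

Set Implicit Arguments.
Unset Strict Implicit.
Unset Printing Implicit Defensive.

Local Open Scope classical_set_scope.

(** * Arithmetic and order of effect algebras *)

Section EffectAlgebraBasics.
Variable E : effectAlgebra.
Implicit Types a b c d p q r t u v w x y z : E.

Lemma sumA a b c ab r : oplus a b = Some ab -> oplus ab c = Some r ->
  exists2 bc, oplus b c = Some bc & oplus a bc = Some r.
Proof.
move=> hab hr; have := oplusA a b c; rewrite hab /= hr.
by case: (oplus b c) => [bc|] //= h; exists bc.
Qed.

Lemma sumAr a b c bc r : oplus b c = Some bc -> oplus a bc = Some r ->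
  exists2 ab, oplus a b = Some ab & oplus ab c = Some r.
Proof.
move=> hbc hr; have := oplusA a b c; rewrite hbc /= hr.
by case: (oplus a b) => [ab|] //= h; exists ab.
Qed.

Lemma sumCA a b c bc r : oplus b c = Some bc -> oplus a bc = Some r ->
  exists2 ac, oplus a c = Some ac & oplus b ac = Some r.
Proof. by rewrite oplusC => hbc /(sumAr hbc) [ac h]; rewrite oplusC; exists ac. Qed.

Lemma complK a : ecompl (ecompl a) = a.
Proof. by apply/esym/ecompl_uniq; rewrite oplusC oplus_compl. Qed.

Lemma compl1 : ecompl eone = ezero :> E.
Proof. by apply: oplus1_def; rewrite oplus_compl. Qed.

Lemma sum0 a : oplus a ezero = Some a.
Proof.
have h1 : oplus (eone : E) ezero = Some eone by rewrite -compl1 oplus_compl.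
have [c hc ha'] := sumA (oplus_compl (ecompl a)) h1.
by move: (ecompl_uniq ha') hc; rewrite complK => ->.
Qed.

(** The summand [b] of [r = a ⊕ b] is recovered as the complement of
    [r' ⊕ a]. *)
Lemma sum_inj a b c r : oplus a b = Some r -> oplus a c = Some r -> b = c.
Proof.
have key d : oplus a d = Some r ->
    exists2 e, oplus (ecompl r) a = Some e & ecompl e = d.
  move=> hd.
  have h1 : oplus (ecompl r) r = Some eone by rewrite oplusC oplus_compl.
  have [e he /ecompl_uniq ->] := sumAr hd h1.
  by exists e.
by move=> /key [e he <-] /key [f]; rewrite he => -[->] <-.
Qed.

Lemma sum_eq0 a b : oplus a b = Some ezero -> a = ezero.
Proof.
have h01 : oplus ezero eone = Some (eone : E) by rewrite oplusC sum0.
rewrite oplusC => hab; have [c hc _] := sumA hab h01.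
by apply: oplus1_def; rewrite oplusC hc.
Qed.

Lemma le0x a : ele ezero a.
Proof. by exists a; rewrite oplusC sum0. Qed.

Lemma lexx a : ele a a.
Proof. by exists ezero; rewrite sum0. Qed.

Lemma le_trans b a c : ele a b -> ele b c -> ele a c.
Proof. by move=> [d hd] [e he]; have [f _ hf] := sumA hd he; exists f. Qed.

Lemma le_anti a b : ele a b -> ele b a -> a = b.
Proof.
move=> [d hd] [e he]; have [f hf hf0] := sumA hd he.
move: hf; rewrite (sum_inj hf0 (sum0 a)) => /sum_eq0 d0.
by move: hd; rewrite d0 sum0 => -[].
Qed.

Lemma lex0 a : ele a ezero -> a = ezero.
Proof. by move=> h; apply: le_anti h (le0x a). Qed.

Lemma le_suml a b c : oplus a b = Some c -> ele a c.
Proof. by exists b. Qed.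

Lemma le_sumr a b c : oplus a b = Some c -> ele b c.
Proof. by rewrite oplusC; exists a. Qed.

Lemma le_sum2l a b c p q : oplus a b = Some p -> oplus a c = Some q ->
  ele b c -> ele p q.
Proof.
move=> hp hq [d hd]; have [p' hp' hq'] := sumAr hd hq.
by move: hp' hq'; rewrite hp => -[<-] hq'; exists d.
Qed.

Lemma le_sum2l_inv a b c p q : oplus a b = Some p -> oplus a c = Some q ->
  ele p q -> ele b c.
Proof.
move=> hp hq [d hd]; have [e he hq'] := sumA hp hd.
by rewrite -(sum_inj hq' hq); exists d.
Qed.

Lemma le_sum_defr a b c q : ele b c -> oplus a c = Some q ->
  exists2 p, oplus a b = Some p & ele p q.
Proof.
by move=> [d hd] hq; have [p hp hpq] := sumAr hd hq; exists p => //; exists d.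
Qed.

Definition orth a b := exists c, oplus a b = Some c.

Lemma orth_sym a b : orth a b -> orth b a.
Proof. by rewrite /orth oplusC. Qed.

Lemma orth_le a b c : ele b c -> orth a c -> orth a b.
Proof. by move=> hbc [q hq]; have [p hp _] := le_sum_defr hbc hq; exists p. Qed.

Lemma orthE a b : orth a b <-> ele a (ecompl b).
Proof.
split=> [/orth_sym [c hc]|hab].
  have [d hd hbd] := sumA hc (oplus_compl c).
  by rewrite -(ecompl_uniq hbd); apply: le_suml hd.
by apply/orth_sym/(orth_le hab); exists eone; rewrite oplus_compl.
Qed.

Lemma compl_le a b : ele a b -> ele (ecompl b) (ecompl a).
Proof.
move=> hab; apply/orthE/(orth_le hab)/orth_sym.
by exists eone; rewrite oplus_compl.
Qed.

Lemma atomP a t : atom a -> ele t a -> t = ezero \/ t = a.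
Proof.
move=> [_ ha] hta; case: (pselect (t = a)) => [|nta]; first by right.
by left; apply: ha; [apply: le0x|].
Qed.

(** * Disjoint elements and sharp elements *)

Definition disj a b := forall t, ele t a -> ele t b -> t = ezero.

Lemma disj_sym a b : disj a b -> disj b a.
Proof. by move=> h t tb ta; apply: h. Qed.

Lemma disj_le a b c : ele b c -> disj a c -> disj a b.
Proof. by move=> hbc h t ta tb; apply: h => //; apply: le_trans tb hbc. Qed.

Lemma disj_atoms a b : atom a -> atom b -> a <> b -> disj a b.
Proof. by move=> ha hb nab t /(atomP ha) [//|->] /(atomP hb) [//|]. Qed.

Lemma disj_atom a x : atom a -> ~ ele a x -> disj a x.
Proof. by move=> ha nax t /(atomP ha) [//|->]. Qed.

Lemma sharpP x : sharp x <-> disj x (ecompl x).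
Proof.
split=> [[_ h] t tx tx'|h].
  by apply/lex0/h => a [->|->].
split=> [a _|z hz]; first exact: le0x.
by rewrite (h z); [apply: lexx | apply: hz; left | apply: hz; right].
Qed.

Lemma sharp_compl x : sharp x -> sharp (ecompl x).
Proof. by move=> /sharpP/disj_sym h; apply/sharpP; rewrite complK. Qed.

Lemma sharp0 : sharp (ezero : E).
Proof. by apply/sharpP => t /lex0. Qed.

Lemma sharp1 : sharp (eone : E).
Proof. by rewrite -[eone]complK compl1; apply/sharp_compl/sharp0. Qed.

(** In a lattice effect algebra these are the pairs whose sum exists and is
    the join of two disjoint elements.  Unlike orthogonality or disjointness
    alone, this relation is inherited by sums. *)
Definition perp a b := orth a b /\ disj a b.

Lemma perp_sym a b : perp a b -> perp b a.
Proof. by move=> [h1 h2]; split; [apply: orth_sym|apply: disj_sym]. Qed.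

Lemma perp_le a b c : ele b c -> perp a c -> perp a b.
Proof. by move=> h [h1 h2]; split; [apply: orth_le h1|apply: disj_le h2]. Qed.

Hypothesis E_lattice : is_lattice E.
Hypothesis E_atomic : atomic E.

Lemma join_ex a b : exists w, [/\ ele a w, ele b w &
  forall z, ele a z -> ele b z -> ele w z].
Proof.
have [[w [ub lub]] _] := E_lattice a b; exists w; split.
- by apply: ub; left.
- by apply: ub; right.
- by move=> z az bz; apply: lub => c [->|->].
Qed.

Lemma meet_ex a b : exists w, [/\ ele w a, ele w b &
  forall z, ele z a -> ele z b -> ele z w].
Proof.
have [_ [w [lb glb]]] := E_lattice a b; exists w; split.
- by apply: lb; left.
- by apply: lb; right.
- by move=> z az bz; apply: glb => c [->|->].
Qed.

(** If [w] is the join of [a] and [b], then [c = w ⊕ d] for some [d], and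
    cancelling [a] and [b] in turn puts [d] below both [b] and [a]. *)
Lemma disj_sum_lub a b c z : disj a b -> oplus a b = Some c ->
  ele a z -> ele b z -> ele c z.
Proof.
move=> hab hc az bz; have [w [aw bw lub]] := join_ex a b.
have [d hd] := lub _ (le_suml hc) (le_sumr hc).
have le_d p q : oplus p q = Some c -> ele p w -> ele d q.
  move=> hpq [e he]; have [f hf hf'] := sumA he hd.
  by rewrite -(sum_inj hf' hpq); apply: le_sumr hf.
have d0 : d = ezero.
  by apply: hab; [apply: le_d bw; rewrite oplusC | apply: le_d aw].
by move: hd; rewrite d0 sum0 => -[<-]; apply: lub.
Qed.

Lemma perp_sum x y z s : perp x y -> perp x z -> oplus y z = Some s -> perp x s.
Proof.
move=> [oxy dxy] [oxz dxz] hs; split.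
  (* x and y both lie below the complement of z, hence so does their sum. *)
  have [c hc] := oxy.
  have /orthE [r hr] : ele c (ecompl z).
    apply: (disj_sum_lub dxy hc); first exact/orthE.
    by apply/orthE; exists s.
  have [s' hs' hr'] := sumA hc hr.
  by move: hs' hr'; rewrite hs => -[<-] hr'; exists r.
move=> t tx ts; apply: (dxz) => //.
have [c hc] : orth y t by apply: orth_le tx (orth_sym oxy).
apply: (le_sum2l_inv hc hs); apply: (disj_sum_lub _ hc) => //.
- exact: disj_le tx (disj_sym dxy).
- exact: le_suml hs.
Qed.

Lemma perp0 x : perp x ezero.
Proof. by split; [exists x; rewrite sum0 | move=> t _ /lex0]. Qed.

Lemma perp_osum x (l : seq E) f : osum l = Some f ->
  (forall c, List.In c l -> perp x c) -> perp x f.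
Proof.
elim: l f => [|c l IH] f /=; first by move=> [<-] _; apply: perp0.
case hl: (osum l) => [f'|] //= hf hx.
apply: (perp_sum _ _ hf); first by apply: hx; left.
by apply: IH => // d hd; apply: hx; right.
Qed.

Lemma perp_nmul x a n p : perp x a -> nmul n a = Some p -> perp x p.
Proof.
move=> hx hp; apply: (perp_osum hp) => c.
by elim: n {hp} => [|n IH] //= [<-|/IH].
Qed.

(** For [z] below [u] and its complement, [z ⊕ a] and [z ⊕ b] are joins of
    elements below [u]; hence [a] and [b], and so [u] itself, lie below the
    difference of [u] and [z], which forces [z = 0]. *)
Lemma sharp_join_disj a b u : ele a u -> ele b u ->
  (forall z, ele a z -> ele b z -> ele u z) ->
  disj a (ecompl u) -> disj b (ecompl u) -> sharp u.
Proof.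
move=> au bu lub da db; apply/sharpP => z zu zu'.
have [r hr] := zu.
have le_r c : ele c u -> disj c (ecompl u) -> ele c r.
  move=> cu dc.
  have [s hs] : orth z c by apply/(orth_le cu)/orthE.
  apply: (le_sum2l_inv hs hr); apply: (disj_sum_lub _ hs) => //.
  exact/disj_sym/(disj_le zu' dc).
have ur : ele u r by apply: lub; apply: le_r.
have eur : u = r by apply: le_anti ur (le_sumr hr).
by move: hr; rewrite -eur oplusC => h; apply: (sum_inj h (sum0 u)).
Qed.

Lemma sharp_join a b u : sharp a -> sharp b -> ele a u -> ele b u ->
  (forall z, ele a z -> ele b z -> ele u z) -> sharp u.
Proof.
move=> /sharpP sa /sharpP sb au bu lub.
apply: (sharp_join_disj au bu lub); first exact: disj_le (compl_le au) sa.
exact: disj_le (compl_le bu) sb.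
Qed.

Lemma sharp_sum a b u : sharp a -> sharp b -> oplus a b = Some u -> sharp u.
Proof.
move=> sa sb hu; apply: (sharp_join sa sb (le_suml hu) (le_sumr hu)) => z.
apply: (disj_sum_lub _ hu) => //.
apply: disj_le (proj1 (sharpP a) sa); apply/orthE.
by apply: orth_sym; exists u.
Qed.

(** The complement of [b] is [u' ⊕ a], a sum of sharp elements. *)
Lemma sharp_diff a b u : sharp a -> sharp u -> oplus a b = Some u -> sharp b.
Proof.
move=> sa su hu; have [c hc hbc] := sumA (etrans (oplusC b a) hu) (oplus_compl u).
rewrite -[b]complK -(ecompl_uniq hbc); apply: sharp_compl.
exact: sharp_sum (sharp_compl su) hc.
Qed.

(** As [u'] is disjoint from [x], the element [x ⊕ u'] is a join, hence is
    below [y']; reassociating, [x ⊕ y] is orthogonal to [u']. *)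
Lemma sharp_sum_le u x y s : sharp u -> ele x u -> ele y u ->
  oplus x y = Some s -> ele s u.
Proof.
move=> /sharpP su xu yu hs; have u'x : ele (ecompl u) (ecompl x) by apply: compl_le.
have [c hc] : orth x (ecompl u) by apply: (orth_sym (proj2 (orthE _ _) u'x)).
have cy : ele c (ecompl y).
  apply: (disj_sum_lub _ hc); last exact: compl_le.
    exact: (disj_sym (disj_le xu (disj_sym su))).
  by apply/orthE; exists s.
have /orthE [r hr] := cy; rewrite oplusC in hr.
have [xy' hxy' hr'] := sumAr hc hr.
rewrite -[u]complK; apply/orthE.
by move: hxy' hr'; rewrite oplusC hs => -[<-] hr'; exists r.
Qed.

(** If [a] were below the complement of [u], which is below that of [b], then
    [a] and [b] would be orthogonal. *)
Lemma sharp_join_nonorth_atoms a b u : atom a -> atom b -> ~ orth a b ->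
  ele a u -> ele b u -> (forall z, ele a z -> ele b z -> ele u z) -> sharp u.
Proof.
move=> ha hb nab au bu lub.
apply: (sharp_join_disj au bu lub); apply: disj_atom => // h; apply: nab.
  by apply/(orth_le bu)/orthE.
by apply/orth_sym/(orth_le au)/orthE.
Qed.

(** * Multiples *)

Lemma nmulS n x p q : nmul n x = Some p -> oplus x p = Some q -> nmul n.+1 x = Some q.
Proof. by rewrite /nmul /= => -> /=. Qed.

Lemma nmulS_inv n x q : nmul n.+1 x = Some q ->
  exists2 p, nmul n x = Some p & oplus x p = Some q.
Proof. by rewrite /nmul /=; case: (osum _) => //= p hp; exists p. Qed.

Lemma nmul1 x : nmul 1 x = Some x.
Proof. by rewrite /nmul /= sum0. Qed.

Lemma nmul_le m n x q : m <= n -> nmul n x = Some q ->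
  exists2 p, nmul m x = Some p & ele p q.
Proof.
move=> /subnK <-; elim: (n - m) q => [|k IH] q hq; first by exists q => //; apply: lexx.
have [r /IH [p hp pr] /le_sumr rq] := nmulS_inv hq.
by exists p => //; apply: le_trans rq.
Qed.

Lemma nmul_mono n a e q : ele a e -> nmul n e = Some q ->
  exists2 p, nmul n a = Some p & ele p q.
Proof.
move=> ae; elim: n q => [|n IH] q.
  by move=> [<-]; exists ezero => //; apply: lexx.
move=> /nmulS_inv [r /IH [p hp pr] hq].
have [s hs sq] := le_sum_defr pr hq; rewrite oplusC in hs.
have [t ht ts] := le_sum_defr ae hs; rewrite oplusC in ht.
by exists t; [apply: nmulS ht | apply: le_trans sq].
Qed.

Lemma le_nmul n x p : 0 < n -> nmul n x = Some p -> ele x p.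
Proof. by case: n => // n _ /nmulS_inv [q _ /le_suml]. Qed.

Lemma sharp_nmul u a n p : sharp u -> ele a u -> nmul n a = Some p -> ele p u.
Proof.
move=> su au; elim: n p => [|n IH] p; first by move=> [<-]; apply: le0x.
by move=> /nmulS_inv [q /IH qu]; apply: sharp_sum_le.
Qed.

Lemma ex_max_nat (P : nat -> Prop) N : P 0 -> (forall n, P n -> n <= N) ->
  exists2 n, P n & forall m, P m -> m <= n.
Proof.
move=> P0 PN.
have exP : exists n, `[< P n >] by exists 0; apply/asboolP.
have leN n : `[< P n >] -> n <= N by move/asboolP/PN.
case: (ex_maxnP exP leN) => n /asboolP Pn maxn; exists n => // m Pm.
by apply: maxn; apply/asboolP.
Qed.

(** Turns the order into a usable maximum: in the Archimedean case the value is
    attained and bounds all multiples that exist. *)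
Lemma archimedean_order a : archimedean E -> a <> ezero -> exists n p,
  [/\ ord a = Some n, nmul n a = Some p & forall m, nmul m a <> None -> m <= n].
Proof.
move=> arch a0; rewrite /ord.
case: asboolP => [h|]; first by case: arch; exists a.
move=> /existsNP [N /not_implyP [N0 /contrapT hN]].
pose P n := nmul n a <> None.
have bound n : P n -> n <= N.
  rewrite /P leqNgt => hn; apply/negP => /ltnW Nn.
  case hq: (nmul n a) hn => [q|] // _.
  by have [p] := nmul_le Nn hq; rewrite hN.
have P0 : P 0 by [].
have [n Pn maxn] := ex_max_nat P0 bound.
have [|] := @getPex _ [set n | nmul n a <> None /\
  forall m, nmul m a <> None -> m <= n]; first by exists n.
move: (get _) => N' PN' maxN'.
by case hp: (nmul N' a) PN' => [p|] // _; exists N', p.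
Qed.

(** An atom [b] below [n a] and its complement is orthogonal to [n a].  It is
    not [a], as [n + 1] copies of [a] do not add up; being a different atom, it
    is disjoint from [n a] too. *)
Lemma nmul_exact_sharp a n p : atom a -> nmul n a = Some p ->
  nmul n.+1 a = None -> sharp p.
Proof.
move=> ha hp hn; apply/sharpP => z zp zp'.
case: (pselect (z = ezero)) => // z0; exfalso.
have [b hb bz] := E_atomic z0.
have obp : orth b p by apply/orthE; apply: le_trans bz zp'.
have ab : a <> b.
  by move=> ab; case: obp => q; rewrite -ab => /(nmulS hp); rewrite hn.
have n0 : 0 < n.
  by case: n hp hn => // _; rewrite nmul1.
have pba : perp b a.
  by split; [apply: orth_le (le_nmul n0 hp) obp | apply/disj_sym/disj_atoms].
have [_ dbp] := perp_nmul pba hp.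
by case: hb => b0 _; apply/b0/dbp; [apply: lexx | apply: le_trans bz zp].
Qed.

(** * Atoms and orthogonal systems below meager elements *)

Definition meager y := forall u, sharp u -> ele u y -> u = ezero.

Lemma meager_atoms_perp y a b : meager y -> atom a -> atom b -> a <> b ->
  ele a y -> ele b y -> perp a b.
Proof.
move=> my ha hb nab ay le_by; split; last exact: disj_atoms.
apply: contrapT => nab'; have [w [aw bw lub]] := join_ex a b.
have w0 : w = ezero.
  by apply: my; [apply: sharp_join_nonorth_atoms nab' aw bw lub | apply: lub].
by case: ha => a0 _; apply: a0; apply: lex0; rewrite -w0.
Qed.

(** By [perp_osum] each new summand is [perp] to the sum so far; their sum
    exists, and being a join it stays below [y]. *)
Lemma perp_system_osum (I : Type) (D : set I) (g : I -> E) y s :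
  (forall i, D i -> ele (g i) y) ->
  (forall i j, D i -> D j -> i <> j -> perp (g i) (g j)) ->
  finite_subsystem D s -> exists2 f, osum (map g s) = Some f & ele f y.
Proof.
move=> gy gp; elim: s => [|i s IH] [nd sD].
  by exists ezero => //; apply: le0x.
have Di : D i by apply: sD; left.
have sD' j : List.In j s -> D j by move=> js; apply: sD; right.
have /List.NoDup_cons_iff [ins nds] := nd.
have [//|f hf fy] := IH.
have [[q hq] dq] : perp (g i) f.
  apply: (perp_osum hf) => c.
  elim: s ins sD' {nd sD IH hf nds} => //= j s IH ins sD' [<-|].
    by apply: gp => //; [apply: sD'; left | move=> ij; apply: ins; left].
  by apply: IH => [h|l ls]; [apply: ins; right | apply: sD'; right].
by exists q; [rewrite /= hf | apply: (disj_sum_lub dq hq) => //; apply: gy].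
Qed.

(** * Orthogonal sums of arbitrary systems *)

Section Bigoplus.
Variables (I : Type).
Implicit Types (D : set I) (g : I -> E) (s : seq I).

Lemma osum_mid g i s1 s2 : osum (map g (s1 ++ i :: s2)%list) =
  obind (oplus (g i)) (osum (map g (s1 ++ s2)%list)).
Proof.
elim: s1 => [//|j s1 IH] /=; rewrite {}IH.
case: (osum _) => [r|] //=.
have h1 := oplusA (g j) (g i) r; have h2 := oplusA (g i) (g j) r.
by rewrite (oplusC (g j)) in h1; apply: etrans (esym h1) h2.
Qed.

Lemma extract_index D g i s : finite_subsystem D s -> List.In i s ->
  exists2 s', finite_subsystem (D `\ i) s' &
    osum (map g s) = obind (oplus (g i)) (osum (map g s')).
Proof.
move=> [nd sD] si; have [s1 [s2 es]] := List.in_split _ _ si.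
subst s.
exists (s1 ++ s2)%list; last exact: osum_mid.
have [nd' nin] := List.NoDup_remove _ _ _ nd; split=> // j js; split.
  by apply: sD; move: js; rewrite !List.in_app_iff /=; tauto.
by move=> ij; apply: nin; rewrite -ij.
Qed.

Lemma finite_subsystem_cons D i s : D i -> finite_subsystem (D `\ i) s ->
  finite_subsystem D (i :: s).
Proof.
move=> Di [nd sD]; split.
  by apply: List.NoDup_cons => // /sD [_]; apply.
by move=> j [<-|/sD []].
Qed.

Lemma finite_subsystem_sub D D' s : D `<=` D' -> finite_subsystem D s ->
  finite_subsystem D' s.
Proof. by move=> DD' [nd sD]; split=> // i /sD /DD'. Qed.

Lemma finite_subsystem_setD1 D i s : finite_subsystem D s -> ~ List.In i s ->
  finite_subsystem (D `\ i) s.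
Proof.
move=> [nd sD] ins; split=> // j js; split; first exact: sD.
by move=> ji; apply: ins; rewrite -ji.
Qed.

Lemma bigoplus_ub D g y s f : is_bigoplus D g y -> finite_subsystem D s ->
  osum (map g s) = Some f -> ele f y.
Proof. by move=> [_ [ub _]] hs hf; apply: ub; exists s. Qed.

Lemma bigoplus_ub1 D g y i : is_bigoplus D g y -> D i -> ele (g i) y.
Proof.
move=> hy Di; apply: (bigoplus_ub (s := [:: i]) hy); last by rewrite /= sum0.
by apply: finite_subsystem_cons => //; split=> //; apply: List.NoDup_nil.
Qed.

Lemma bigoplus_orth2 D g y i j : is_bigoplus D g y -> D i -> D j -> i <> j ->
  orth (g i) (g j).
Proof.
move=> [ort _] Di Dj ij; have := ort [:: i; j].
rewrite /= sum0 /=; case h: (oplus _ _) => [c|]; first by exists c.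
case=> //; apply: finite_subsystem_cons => //; apply: finite_subsystem_cons.
  by split=> // ji; apply: ij.
by split=> //; apply: List.NoDup_nil.
Qed.

Lemma bigoplus_set0 g : is_bigoplus set0 g ezero.
Proof.
have nil s : finite_subsystem set0 s -> s = [::].
  by case: s => // i s [_ /(_ i)] h; case: h; left.
split; first by move=> s /nil ->.
split; first by move=> a [s /nil ->] [<-]; apply: lexx.
by move=> z _; apply: le0x.
Qed.

(** For [t] below [x] and [y], each finite partial sum [f] gives [t ⊕ f ≤ y]
    as a join, so the difference of [y] and [t] is an upper bound of the partial
    sums and cannot be smaller than [y]. *)
Lemma perp_bigoplus x D g y : (forall i, D i -> perp x (g i)) ->
  is_bigoplus D g y -> disj x y.
Proof.
move=> hx hy t tx ty; have [r hr] := ty.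
have yr : ele y r.
  case: (hy) => _ [_ lub]; apply: lub => f [s hs hf].
  have [[q hq] dq] : perp t f.
    apply: perp_sym; apply: (perp_le tx); apply: perp_sym.
    apply: (perp_osum hf) => c; have [_] := hs.
    elim: s {hs hf} => //= j s IH sD [<-|]; first by apply/hx/sD; left.
    by apply: IH => i si; apply: sD; right.
  apply: (le_sum2l_inv hq hr); apply: (disj_sum_lub dq hq ty).
  exact: bigoplus_ub hy hs hf.
have eyr : r = y by apply: le_anti yr; apply: le_sumr hr.
by move: hr; rewrite eyr oplusC => h; apply: (sum_inj h (sum0 y)).
Qed.

(** Translation by [g i] preserves suprema inside the interval below [y]; an
    arbitrary upper bound [z] is first met with [r] so that [g i] can be added
    to it. *)
Lemma bigoplus_remove D g y i : is_bigoplus D g y -> D i ->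
  exists2 r, oplus (g i) r = Some y & is_bigoplus (D `\ i) g r.
Proof.
move=> hy Di; have [r hr] := bigoplus_ub1 hy Di; exists r => //.
have sub : D `\ i `<=` D by move=> j [].
case: (hy) => ort [ub lub]; split.
  by move=> s /(finite_subsystem_sub sub); apply: ort.
split=> [f [s hs hf]|z hz].
  have := ort _ (finite_subsystem_cons Di hs); rewrite /= hf /=.
  case hq: (oplus _ _) => [q|] // _.
  apply: (le_sum2l_inv hq hr); apply: (bigoplus_ub hy (finite_subsystem_cons Di hs)).
  by rewrite /= hf.
have [m [mz mr glb]] := meet_ex z r; apply: le_trans mz.
have [q hq _] := le_sum_defr mr hr.
apply: (le_sum2l_inv hr hq); apply: lub => f [s hs hf].
have low s' f' : finite_subsystem (D `\ i) s' -> osum (map g s') = Some f' -> ele f' m.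
  move=> hs' hf'; apply: glb; first by apply: hz; exists s'.
  have := ort _ (finite_subsystem_cons Di hs'); rewrite /= hf' /=.
  case hp: (oplus _ _) => [p|] // _.
  apply: (le_sum2l_inv hp hr); apply: (bigoplus_ub hy (finite_subsystem_cons Di hs')).
  by rewrite /= hf'.
case: (pselect (List.In i s)) => [ins|nins].
  have [s' hs' e] := extract_index g hs ins; move: hf; rewrite e.
  case hf': (osum _) => [f'|] //= hf.
  exact: le_sum2l hf hq (low _ _ hs' hf').
apply: le_trans (le_sumr hq); apply: low hf.
exact: finite_subsystem_setD1.
Qed.

Lemma bigoplus_add D g y i z : ~ D i -> is_bigoplus D g y ->
  oplus (g i) y = Some z -> is_bigoplus (D `|` [set i]) g z.
Proof.
move=> Di hy hz.
have subl : (D `|` [set i]) `\ i `<=` D by move=> j [[]].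
have subr : D `<=` (D `|` [set i]) `\ i.
  by move=> j Dj; split; [left | move=> ji; apply: Di; rewrite -ji].
have Di' : (D `|` [set i]) i by right.
case: (hy) => ort [ub lub].
have ub' s : finite_subsystem (D `|` [set i]) s ->
    exists2 f, osum (map g s) = Some f & ele f z.
  move=> hs; case: (pselect (List.In i s)) => [ins|nins].
    have [s' /(finite_subsystem_sub subl) hs' ->] := extract_index g hs ins.
    case hf': (osum _) (ort _ hs') => [f'|] // _.
    by have [q hq qz] := le_sum_defr (bigoplus_ub hy hs' hf') hz; exists q.
  have hs' := finite_subsystem_sub subl (finite_subsystem_setD1 hs nins).
  case hf': (osum _) (ort _ hs') => [f'|] // _; exists f' => //.
  exact: le_trans (bigoplus_ub hy hs' hf') (le_sumr hz).
split; first by move=> s /ub' [f ->].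
split=> [f [s /ub' [f' ->]] f'z [<-] //|u hu].
have hul s f : finite_subsystem D s -> osum (map g s) = Some f ->
    exists2 q, oplus (g i) f = Some q & ele q u.
  move=> hs hf; have [q hq _] := le_sum_defr (bigoplus_ub hy hs hf) hz.
  exists q => //; apply: hu; exists (i :: s); last by rewrite /= hf.
  by apply: finite_subsystem_cons => //; apply: finite_subsystem_sub hs.
have [q] : exists2 q, oplus (g i) ezero = Some q & ele q u.
  by apply: (hul [::]) => //; split=> //; apply: List.NoDup_nil.
rewrite sum0 => -[<-] [d hd].
apply: (le_sum2l hz hd); apply: lub => f [s hs hf].
have [p hp pu] := hul _ _ hs hf.
exact: le_sum2l_inv hp hd pu.
Qed.

Lemma bigoplus_ext D g g' y : (forall i, D i -> g i = g' i) ->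
  is_bigoplus D g y -> is_bigoplus D g' y.
Proof.
move=> gg' [ort [ub lub]].
have eqs s : finite_subsystem D s -> map g s = map g' s.
  move=> [_]; elim: s => //= i s IH sD; rewrite gg' ?IH //; last by apply: sD; left.
  by move=> j js; apply: sD; right.
split; first by move=> s hs; rewrite -(eqs _ hs); apply: ort.
split=> [f [s hs]|z hz]; first by rewrite -(eqs _ hs) => hf; apply: ub; exists s.
by apply: lub => f [s hs hf]; apply: hz; exists s => //; rewrite -(eqs _ hs).
Qed.

End Bigoplus.

(** * Meager elements as sums of multiples of atoms *)

(** The largest multiples below [y] add up to [y]: were the meet [m] of [y]
    with an upper bound of the partial sums smaller than [y], an atom [b] of
    the difference could be added to the multiple of [b] already below [m]. *)
Lemma meager_bigoplus y : archimedean E -> meager y -> exists k g,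
  [/\ forall a, atom a -> ele a y -> 0 < k a /\ Some (k a) <> ord a,
      forall a, atom a -> ele a y -> nmul (k a) a = Some (g a)
    & is_bigoplus [set a | atom a /\ ele a y] g y].
Proof.
move=> arch my.
have /choice [kg hkg] : forall a, exists kg : nat * E, atom a -> ele a y ->
    [/\ nmul kg.1 a = Some kg.2, ele kg.2 y &
      forall m p, nmul m a = Some p -> ele p y -> m <= kg.1].
  move=> a; case: (pselect (atom a)) => [ha|]; last by exists (0, ezero).
  have [N [_ [_ _ maxN]]] := archimedean_order arch (proj1 ha).
  pose P n := exists2 p, nmul n a = Some p & ele p y.
  have [||n [p hp py] maxn] := @ex_max_nat P N.
  - by exists ezero => //; apply: le0x.
  - by move=> n [p hp _]; apply: maxN; rewrite hp.
  by exists (n, p) => _ _; split=> // m q hq qy; apply: maxn; exists q.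
pose k a := (kg a).1; pose g a := (kg a).2.
have hk a : atom a -> ele a y -> 0 < k a.
  by move=> ha ay; have [_ _ h] := hkg a ha ay; apply: h ay; apply: nmul1.
exists k, g; split=> [a ha ay|a ha ay|]; last 1 first.
- have gy a : atom a /\ ele a y -> ele (g a) y by move=> [ha /(hkg a ha) []].
  have gp a b : atom a /\ ele a y -> atom b /\ ele b y -> a <> b ->
      perp (g a) (g b).
    move=> [ha ay] [hb le_by] nab.
    have [hga _ _] := hkg a ha ay; have [hgb _ _] := hkg b hb le_by.
    apply: (perp_nmul _ hgb); apply: perp_sym; apply: (perp_nmul _ hga).
    exact/perp_sym/(meager_atoms_perp my).
  split; first by move=> s /(perp_system_osum gy gp) [f ->].
  split=> [f [s hs hf]|z hz].
    by have [f'] := perp_system_osum gy gp hs; rewrite hf => -[<-].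
  have [m [mz my' glb]] := meet_ex z y; have [d hd] := my'.
  case: (pselect (d = ezero)) => [d0|/E_atomic [b hb bd]].
    by move: hd; rewrite d0 sum0 => -[<-].
  have le_by : ele b y by apply: le_trans bd (le_sumr hd).
  have [hgb gby maxb] := hkg b hb le_by.
  have gbm : ele (g b) m.
    apply: glb => //; apply: hz; exists [:: b]; last by rewrite /= sum0.
    split; last by move=> c [<-|].
    by apply: List.NoDup_cons => //; apply: List.NoDup_nil.
  have [q hq qy] := le_sum_defr bd hd; rewrite oplusC in hq.
  have [r hr rq] := le_sum_defr gbm hq.
  have := maxb _ _ (nmulS hgb hr) (le_trans rq qy).
  by rewrite ltnn.
- split; first exact: hk.
  have [n [p [-> hp maxn]]] := archimedean_order arch (proj1 ha).
  have [hg gy _] := hkg a ha ay; move=> -[ekn].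
  have g0 : g a = ezero.
    apply: my gy; apply: (nmul_exact_sharp ha hg); rewrite -/(k a) ekn.
    case hn: (nmul n.+1 a) => [q|] //.
    suff : n < n by rewrite ltnn.
    by apply: maxn; rewrite hn.
  case: (ha) => a0 _; apply: a0; apply: lex0; rewrite -g0.
  by apply: le_nmul hg; apply: hk.
- by have [] := hkg a ha ay.
Qed.

(** * Atoms below a sum of non-exhausted multiples of atoms *)

Section Bounded.
Hypothesis E_arch : archimedean E.
Variables (A : set E) (k : E -> nat) (g : E -> E) (y : E).
Hypothesis A_atom : forall a, A a -> atom a.
Hypothesis k_ord : forall a, A a -> 0 < k a /\ Some (k a) <> ord a.
Hypothesis g_nmul : forall a, A a -> nmul (k a) a = Some (g a).
Hypothesis y_sum : is_bigoplus A g y.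

(** Otherwise [a] would lie below the sum of the remaining summands, which are
    multiples of atoms distinct from and orthogonal to [a]. *)
Lemma nmul_bigoplus_lt a p : A a -> nmul (k a).+1 a = Some p -> ~ ele p y.
Proof.
move=> Aa hp py; have [r hr hr'] := bigoplus_remove y_sum Aa.
have [q] := nmulS_inv hp; rewrite g_nmul // => -[<-]; rewrite oplusC => hp'.
have ar : ele a r := le_sum2l_inv hp' hr py.
case: (A_atom Aa) => a0 _; apply: a0.
apply: (perp_bigoplus _ hr') => //; last exact: lexx.
move=> c [Ac ca]; apply: perp_nmul (g_nmul Ac); split.
  have ac : orth (g a) (g c) by apply: (bigoplus_orth2 y_sum) => // /esym.
  have agc := orth_le (le_nmul (proj1 (k_ord Ac)) (g_nmul Ac)) ac.
  exact/orth_sym/(orth_le (le_nmul (proj1 (k_ord Aa)) (g_nmul Aa)))/orth_sym.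
by apply: disj_atoms; [apply: A_atom | apply: A_atom | move/esym].
Qed.

(** Such a [u] would contain [ord(a) a], and thereby the multiple
    [k a + 1]. *)
Lemma not_sharp_le_bigoplus a u : A a -> sharp u -> ele u y -> ~ ele a u.
Proof.
move=> Aa su uy au.
have [n [p [on hp maxn]]] := archimedean_order E_arch (proj1 (A_atom Aa)).
have [_] := k_ord Aa; rewrite on => kn.
have kn' : k a < n.
  rewrite ltn_neqAle maxn ?g_nmul // andbT; apply/eqP => e; apply: kn.
  by rewrite e.
have [q hq qp] := nmul_le kn' hp.
apply: (nmul_bigoplus_lt Aa hq); apply: le_trans qp _.
exact: le_trans (sharp_nmul su au hp) uy.
Qed.

(** If [b] is orthogonal to every atom of [A], it is disjoint from [y]; if not,
    its join with an atom of [A] is a sharp element below [y]. *)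
Lemma bigoplus_atom_in b : atom b -> ele b y -> A b.
Proof.
move=> hb le_by; apply: contrapT => nAb.
have [b0 _] := hb; apply: b0.
apply: (perp_bigoplus _ y_sum) (le_by); last exact: lexx.
move=> a Aa; apply: perp_nmul (g_nmul Aa); split; last first.
  by apply: disj_atoms => //; [apply: A_atom | move=> ba; apply: nAb; rewrite ba].
apply: contrapT => nba; have [w [bw aw lub]] := join_ex b a.
apply: (not_sharp_le_bigoplus Aa _ _ aw).
  exact: (sharp_join_nonorth_atoms hb (A_atom Aa) nba bw aw lub).
apply: lub => //; apply: le_trans (bigoplus_ub1 y_sum Aa).
exact: le_nmul (proj1 (k_ord Aa)) (g_nmul Aa).
Qed.

Lemma bigoplus_atoms : A = [set a | atom a /\ ele a y].
Proof.
apply/seteqP; split=> a; last by move=> [ha ay]; apply: bigoplus_atom_in.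
move=> Aa; split; first exact: A_atom.
apply: le_trans (bigoplus_ub1 y_sum Aa).
exact: le_nmul (proj1 (k_ord Aa)) (g_nmul Aa).
Qed.

Lemma bigoplus_mult_max a n p : A a -> nmul n a = Some p -> ele p y -> n <= k a.
Proof.
move=> Aa hp py; rewrite leqNgt; apply/negP => kn.
have [q hq qp] := nmul_le kn hp.
exact: nmul_bigoplus_lt Aa hq (le_trans qp py).
Qed.

Lemma bigoplus_meager : meager y.
Proof.
move=> u su uy; apply: contrapT => /E_atomic [b hb bu].
have Ab : A b by apply: bigoplus_atom_in => //; apply: le_trans bu uy.
exact: not_sharp_le_bigoplus Ab su uy bu.
Qed.

End Bounded.

(** * Decompositions and the greatest sharp element *)

Definition greatest_sharp x v :=
  [/\ sharp v, ele v x & forall w, sharp w -> ele w x -> ele w v].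

(** The join of [v] with another sharp element below [x] is sharp, and its
    difference with [v] is a sharp element below the meager [y]. *)
Lemma meager_greatest_sharp x v y : sharp v -> oplus v y = Some x ->
  meager y -> greatest_sharp x v.
Proof.
move=> sv hx my; split=> //; first exact: le_suml hx.
move=> w sw wx; have [j [vj wj lub]] := join_ex v w.
have sj : sharp j by apply: sharp_join vj wj lub.
have jx : ele j x by apply: lub => //; apply: le_suml hx.
have [d hd] := vj.
have d0 : d = ezero.
  by apply: my; [apply: sharp_diff sj hd | apply: le_sum2l_inv hd hx jx].
by move: hd; rewrite d0 sum0 => -[->].
Qed.

Lemma greatest_sharp_meager x v y : greatest_sharp x v -> oplus v y = Some x ->
  meager y.
Proof.
move=> [sv vx gv] hx u su uy; have [w hw wx] := le_sum_defr uy hx.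
have wv : ele w v by apply: gv wx; apply: sharp_sum hw.
have ewv : w = v by apply: le_anti wv (le_suml hw).
by move: hw; rewrite ewv => h; apply: (sum_inj h (sum0 v)).
Qed.

Lemma greatest_sharp_uniq x v w :
  greatest_sharp x v -> greatest_sharp x w -> v = w.
Proof.
by move=> [sv vx gv] [sw wx gw]; apply: le_anti; [apply: gw | apply: gv].
Qed.

(** Complementation exchanges least sharp upper bounds and greatest sharp lower
    bounds. *)
Lemma sharply_dominatingP : sharply_dominating E <->
  forall x : E, exists v, greatest_sharp x v.
Proof.
split=> h x; have [v [sv xv mv]] := h (ecompl x); exists (ecompl v); split.
- exact: sharp_compl.
- by rewrite -[x in ele _ x]complK; apply: compl_le.
- move=> w sw wx; rewrite -[w]complK; apply/compl_le/mv; first exact: sharp_compl.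
  exact: compl_le.
- exact: sharp_compl.
- by rewrite -[x in ele x _]complK; apply: compl_le.
- move=> w sw xw; rewrite -[w]complK; apply/compl_le/mv; first exact: sharp_compl.
  exact: compl_le.
Qed.

Lemma decomposition_greatest_sharp x v A k : archimedean E ->
  decomposition x v A k -> greatest_sharp x v.
Proof.
move=> arch [sv hA hk [g [y [hg hy hx]]]].
exact: meager_greatest_sharp sv hx (bigoplus_meager arch hA hk hg hy).
Qed.

Lemma decomposition_uniq x v1 v2 A1 A2 k1 k2 : archimedean E ->
  decomposition x v1 A1 k1 -> decomposition x v2 A2 k2 ->
  [/\ v1 = v2, A1 = A2 & forall a, A1 a -> k1 a = k2 a].
Proof.
move=> arch d1 d2.
have ev : v1 = v2.
  apply: (@greatest_sharp_uniq x); first exact: decomposition_greatest_sharp d1.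
  exact: decomposition_greatest_sharp d2.
case: d1 d2 => _ hA1 hk1 [g1 [y1 [hg1 hy1 hx1]]] [_ hA2 hk2 [g2 [y2 [hg2 hy2]]]].
rewrite -ev => hx2; have ey := sum_inj hx2 hx1; rewrite {}ey in hy2.
have eA : A1 = A2.
  rewrite (bigoplus_atoms arch hA1 hk1 hg1 hy1).
  by rewrite (bigoplus_atoms arch hA2 hk2 hg2 hy2).
split=> // a A1a; have A2a : A2 a by rewrite -eA.
apply/eqP; rewrite eqn_leq; apply/andP; split.
  exact: (bigoplus_mult_max hA2 hk2 hg2 hy2 A2a (hg1 _ A1a) (bigoplus_ub1 hy1 A1a)).
exact: (bigoplus_mult_max hA1 hk1 hg1 hy1 A1a (hg2 _ A2a) (bigoplus_ub1 hy2 A2a)).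
Qed.

Lemma decomposition_exists x v : archimedean E -> greatest_sharp x v ->
  exists A k, decomposition x v A k.
Proof.
move=> arch gv; have [sv [y hy] _] := gv.
have [k [g [hk hg hs]]] := meager_bigoplus arch (greatest_sharp_meager gv hy).
exists [set a | atom a /\ ele a y], k; split=> // [a [] //|a []|]; first exact: hk.
by exists g, y; split=> // a []; apply: hg.
Qed.

Lemma decomposition1 k : decomposition eone (eone : E) set0 k.
Proof.
split=> //; first exact: sharp1.
by exists id, ezero; split=> //; [apply: bigoplus_set0 | apply: sum0].
Qed.

(** When [a] has infinite order, every positive multiplicity is allowed, so one
    more copy of [a] may be added whether or not [a] already occurs. *)
Lemma decomposition_add_atom a x z v A k : atom a -> ord a = None ->
  decomposition x v A k -> oplus a x = Some z ->
  exists k', decomposition z v (A `\ a `|` [set a]) k'.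
Proof.
move=> ha oa [sv hA hk [g [y [hg hy hx]]]] hz.
(* [n] is the multiplicity of [a] in the given decomposition, 0 if absent. *)
have [n [p [r [hn hr hpr]]]] : exists n p r,
    [/\ nmul n a = Some p, is_bigoplus (A `\ a) g r & oplus p r = Some y].
  case: (pselect (A a)) => [Aa|nAa].
    by have [r hr hr'] := bigoplus_remove hy Aa; exists (k a), (g a), r; rewrite hg.
  exists 0, ezero, y; split=> //; last by rewrite oplusC sum0.
  suff -> : A `\ a = A by [].
  by apply/seteqP; split=> [c []|c Ac] //; split=> // ca; apply: nAa; rewrite -ca.
have [y' hy' hx'] := sumCA hx hz.
have [p' hp' hpr'] := sumAr hpr hy'.
pose k' c := if `[< c = a >] then n.+1 else k c.
pose g' c := if `[< c = a >] then p' else g c.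
have ka : k' a = n.+1 by rewrite /k'; case: asboolP.
have ga : g' a = p' by rewrite /g'; case: asboolP.
have kc c : c <> a -> k' c = k c by rewrite /k'; case: asboolP.
have gc c : c <> a -> g' c = g c by rewrite /g'; case: asboolP.
exists k'; split=> //.
- by move=> c [[/hA]|->].
- move=> c [[Ac ca]|->]; first by rewrite kc //; apply: hk.
  by rewrite ka oa.
exists g', y'; split=> //.
- move=> c [[Ac ca]|->]; first by rewrite kc // gc //; apply: hg.
  by rewrite ka ga; apply: nmulS hp'.
apply: (@bigoplus_add _ _ _ r); [by case=> _; apply | | by rewrite ga].
by apply: bigoplus_ext hr => c [_ ca]; rewrite gc.
Qed.

(** An atom [a] of infinite order turns a decomposition of its complement into
    a nontrivial decomposition of one. *)
Lemma unique_decomposition_archimedean :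
  (forall x : E, x <> ezero -> unique_decomposition x) -> archimedean E.
Proof.
move=> H [e e0 he]; have [a ha ae] := E_atomic e0.
have oa : ord a = None.
  rewrite /ord; case: asboolP => // -[] n /he.
  by case hq: (nmul n e) => [q|] // _; have [p -> _] := nmul_mono ae hq.
have a'0 : ecompl a <> ezero.
  move=> a'0; have a1 : a = eone by rewrite -[a]complK a'0 -compl1 complK.
  have := he 2 isT; case hq: (nmul 2 e) => [q|] // _.
  have [p] := nmul_mono ae hq; rewrite a1 /nmul /= sum0 /= => h1 _.
  by case: ha => a0 _; apply: a0; rewrite a1; apply: oplus1_def; rewrite h1.
have [[v [A [k hd]]] _] := H _ a'0.
have [k' hd'] := decomposition_add_atom ha oa hd (oplus_compl a).
have one0 : eone <> ezero :> E.
  move=> e1; case: ha => a0 _; apply: a0; apply: lex0; rewrite -e1.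
  by exists (ecompl a); rewrite oplus_compl.
have [_ uniq1] := H _ one0.
have [_ eA _] := uniq1 _ _ _ _ _ _ (decomposition1 k') hd'.
have : (A `\ a `|` [set a]) a by right.
by rewrite -eA.
Qed.

End EffectAlgebraBasics.

Theorem theorem3p4 (E : effectAlgebra)
  (E_lattice : is_lattice E) (E_atomic : atomic E) :
  (archimedean E /\ sharply_dominating E) <->
  (forall x : E, x <> ezero -> unique_decomposition x).
Proof.
split=> [[arch /sharply_dominatingP sd] x _|H].
  have [v gv] := sd x; split.
    by exists v; apply: decomposition_exists.
  by move=> v1 v2 A1 A2 k1 k2; apply: decomposition_uniq.
have arch := unique_decomposition_archimedean E_lattice E_atomic H.
split=> //; apply/sharply_dominatingP => x.
case: (pselect (x = ezero)) => [->|/H [[v [A [k hd]]] _]].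
  exists ezero; split=> //; [exact: sharp0 | exact: lexx].
by exists v; apply: decomposition_greatest_sharp hd.
Qed.
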